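(* For every odd prime $p$, every skew morphism of the cyclic group $\mathrm{C}_{16p}$ is coset-preserving.
   Context: For a finite group $B$, a skew morphism of $B$ is a permutation $\varphi$ of $B$ fixing the identity such that for every $a\in B$ there is a positive integer $i_a$ with $\varphi(ab)=\varphi(a)\varphi^{i_a}(b)$ for all $b\in B$. Its order $\mathrm{ord}(\varphi)$ is the order of $\langle\varphi\rangle$. The power function $\pi$ maps $a$ to the unique such $i_a\in\{1,\dots,\mathrm{ord}(\varphi)\}$ (with $\pi\equiv1$ for the identity). $\varphi$ is coset-preserving if $\pi(\varphi(a))=\pi(a)$ for all $a\in B$. *)

(* Defs.v *)
From HB Require Import structures.
From mathcomp Require Import all_boot all_fingroup all_solvable.

Set Implicit Arguments.
Unset Strict Implicit.
Unset Printing Implicit Defensive.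

Local Open Scope group_scope.

(* The finite group B is the whole of [gT]; [phi ^+ i] is the i-th iterate of  *)
(* [phi] in {perm gT}, and #[phi] is ord(phi).                                *)
Definition is_exponent_at (gT : finGroupType) (phi : {perm gT}) (a : gT)
    (i : nat) : bool :=
  [forall b : gT, phi (a * b) == phi a * (phi ^+ i) b].

Definition skew_morphism (gT : finGroupType) (phi : {perm gT}) : Prop :=
  phi 1 = 1 /\
  (forall a : gT, exists i : nat, 0 < i /\ is_exponent_at phi a i).

(* Ordinals i < #[phi] encode the exponents i.+1 in {1, ..., ord(phi)}. The    *)
(* default 0 is never taken when [phi] is a skew morphism.                    *)
Definition power_function (gT : finGroupType) (phi : {perm gT}) (a : gT) : nat :=
  if [pick i : 'I_#[phi] | is_exponent_at phi a i.+1] is Some i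
  then i.+1 else 0.

Lemma power_functionP (gT : finGroupType) (phi : {perm gT}) (a : gT) (i : nat) :
  skew_morphism phi ->
  power_function phi a = i <-> 0 < i <= #[phi] /\ is_exponent_at phi a i.
Proof.
move=> [_ skew]; have inj j k : is_exponent_at phi a j ->
    is_exponent_at phi a k -> phi ^+ j = phi ^+ k.
  move=> /forallP Hj /forallP Hk; apply/permP => b.
  by apply: (mulgI (phi a)); rewrite -(eqP (Hj b)) (eqP (Hk b)).
rewrite /power_function; case: pickP => [j Hj | none].
  split=> [<- | [/andP[i0 ile] Hi]]; first by rewrite ltn_ord.
  have /eqP := inj _ _ Hj Hi; case: i i0 ile Hi => // i _ ilt _.
  rewrite !expgS => /eqP/mulgI/eqP.
  by rewrite eq_expg_mod_order !modn_small // => /eqP->.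
have [k [k0 /forallP Hk]] := skew a.
have lt: k.-1 %% #[phi] < #[phi] by rewrite ltn_mod order_gt0.
have /negP[] := none (Ordinal lt); apply/forallP => b.
suff -> : phi ^+ (Ordinal lt).+1 = phi ^+ k by apply: Hk.
by rewrite -[in RHS](prednK k0) !expgS /= expg_mod_order.
Qed.

Definition coset_preserving (gT : finGroupType) (phi : {perm gT}) : Prop :=
  forall a : gT, power_function phi (phi a) = power_function phi a.

(* Main.v *)
(* Left translations B and C = <phi> generate a factorised group G = B C with *)
(* C core-free.  With K the core of B, phi is coset-preserving as soon as     *)
(* C K is normal in G, and this is proved by induction on |B|.  Let E be the  *)
(* core of C K.  Induction in G / E gives [b, c] = x f with x in B, f in C    *)
(* and <x>E normal.  Since x and f centralise K, and x centralises E / K,     *)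
(* core-freeness forces the order u of x modulo K to divide both |K| and      *)
(* |B : K|, so u divides 4.  If C K is not normal, a parity argument in G / E *)
(* gives 2u | |B : K|, hence u = 2 as 32 does not divide |B|.  Expanding      *)
(* (b^c)^N = (b x f)^N for suitable N then gives a contradiction.             *)

Require Import Defs.
From HB Require Import structures.
From mathcomp Require Import all_boot all_fingroup all_solvable.
From mathcomp Require Import zify.

Set Implicit Arguments.
Unset Strict Implicit.
Unset Printing Implicit Defensive.

Local Open Scope group_scope.

(** In the symmetric group on the underlying set, the skew identity says that translations and [phi]
    generate a product of two cyclic groups; [C] is core-free because it fixes 1 and the
    translations are transitive. If [C K] is normal, the translation by a^-1 phi(a) lies in [K],
    which [phi] normalises, so a and phi(a) have the same exponent ([skew_coset_preserving]).

    Normality of [C K] is [mulg_gcore_normal]. There [K] is nontrivial because a core-free cyclic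
    factor is smaller than the other one ([gcore_cyclic_neq1]), so induction reaches G / E.
    Core-freeness then acts through [expg_core_free]: if a normal abelian subgroup is U V with U
    core-free, the exponent of U divides that of V. Used in G and in G / K, this makes the order of
    x modulo [K] divide |K|. Since it also divides |B : K|, its square divides 16p, and
    [twist_order] leaves only order 2.

    [twist_order2_absurd] excludes that case. With g = b x one has b^c = g f; for N = ord(b)/4,
    conjugation by c inverts b^N, and g^N is the same inverse, but (g f)^N differs from g^N because
    the binomial coefficient C(N,2) is 2 modulo 4. *)

(** * Products of two cyclic groups, one of them core-free *)

(* The intersection is the only subgroup of its order in either of the cyclic *)
(* groups C and C :^ b, so b normalises it.                                   *)
Lemma gcore_TI_conj (gT : finGroupType) (G C : {group gT}) b :
    cyclic C -> G \subset <<b |: C>> -> gcore C G = 1 -> C :&: C :^ b = 1.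
Proof.
move=> cycC sG core1.
have eqD : ((C :&: C :^ b) :^ b^-1)%G :=: (C :&: C :^ b)%G.
  apply/eqP; rewrite (eq_subG_cyclic cycC) ?cardJg //= ?subsetIl //.
  by rewrite conjIg conjsgK subsetIr.
apply/trivgP; rewrite -core1 gcore_max ?subsetIl //.
apply: subset_trans sG _; rewrite gen_subG subUset sub1set.
rewrite -groupV inE /= eqD subxx /=.
apply: subset_trans (cyclic_abelian cycC) _.
exact: subset_trans (centS (subsetIl _ _)) (cent_sub _).
Qed.

Lemma mulg_gen_cycle (gT : finGroupType) (G C : {group gT}) b :
  <[b]> * C = G -> G = <<b |: C>> :> {set gT}.
Proof.
move=> defG; apply/eqP; rewrite eqEsubset -{1}defG mul_subG //=.
- by rewrite gen_subG subUset sub1set -defG mulG_subr -{1}(mulg1 b) mem_mulg ?cycle_id.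
- by rewrite genS ?subsetUl.
by rewrite sub_gen ?subsetUr.
Qed.

(** Both factors are abelian, so their intersection is central in [G], hence inside the core. *)
Lemma TI_core_free_factor (gT : finGroupType) (G : {group gT}) (b c : gT) :
  <[b]> * <[c]> = G -> gcore <[c]> G = 1 -> <[b]> :&: <[c]> = 1.
Proof.
move=> defG core1; apply/trivgP; rewrite -core1 gcore_max ?subsetIr //.
rewrite -defG mul_subG //.
  apply: subset_trans (cycle_abelian b) _.
  exact: subset_trans (centS (subsetIl _ _)) (cent_sub _).
apply: subset_trans (cycle_abelian c) _.
exact: subset_trans (centS (subsetIr _ _)) (cent_sub _).
Qed.

(** [C] meets [C :^ b] trivially, so |C|^2 is at most |B||C|. Equality would make [G] the product of
    two conjugates of [C], which is impossible for a proper subgroup. *)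
Lemma card_core_free_factor (gT : finGroupType) (G B C : {group gT}) :
    B * C = G -> cyclic B -> cyclic C -> gcore C G = 1 -> B :!=: 1 ->
  #|C| < #|B|.
Proof.
move=> defG /cyclicP[b defB] cycC core1 ntB.
have sBG : B \subset G by rewrite -defG mulG_subl.
have sCG : C \subset G by rewrite -defG mulG_subr.
have bG : b \in G by rewrite (subsetP sBG) // defB cycle_id.
rewrite ltnNge; apply: contra ntB => leBC.
have TI : C :&: C :^ b = 1.
  by apply: gcore_TI_conj core1 => //; rewrite -(@mulg_gen_cycle _ G) -?defB.
(* Otherwise G = C * C :^ b, and b = c1 * c2 ^ b forces b = c2 * c1. *)
have /(_ b bG) : forall g, g \in G -> g \in C * C :^ b.
  have sCb : C :^ b \subset G by rewrite conj_subG.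
  suff /eqP-> : C * C :^ b == G by [].
  rewrite eqEcard mul_subG //= (TI_cardMg TI) cardJg.
  apply: (@leq_trans (#|B| * #|C|)%N); last by rewrite leq_mul.
  by rewrite mul_cardG -defG leq_pmulr ?cardG_gt0.
case/mulsgP=> c1 _ C1 /imsetP[c2 C2 ->] Db.
have Cb : b \in C.
  have : b * b^-1 = c1 * (b^-1 * c2) by rewrite {1}Db /conjg !mulgA mulgK.
  rewrite mulgV => E1; suff -> : b = c2 * c1 by rewrite groupM.
  by rewrite -[c2](mulKVg b) -[b^-1 * c2](mulKg c1) -E1 mulg1 mulgKV.
have sBC : B \subset C by rewrite defB cycle_subG.
have eCG : C = G :> {set gT} by apply/eqP; rewrite eqEsubset sCG -defG mul_subG.
by rewrite -subG1 -core1 (subset_trans sBC) // gcore_max // eCG normG.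
Qed.

(** If both cores were trivial, each factor would be smaller than the other. *)
Lemma gcore_cyclic_neq1 (gT : finGroupType) (G B C : {group gT}) :
    B * C = G -> cyclic B -> cyclic C -> gcore C G = 1 -> B :!=: 1 ->
  gcore B G != 1.
Proof.
move=> defG cycB cycC core1 ntB; apply/eqP=> coreB1.
have ltCB := card_core_free_factor defG cycB cycC core1 ntB.
have defG' : C * B = G.
  by rewrite -defG; apply/esym/comm_group_setP; rewrite defG groupP.
have [C1 | ntC] := eqVneq (C : {set gT}) 1.
  case/eqP: ntB; apply/trivgP; rewrite -coreB1 gcore_max //.
  by rewrite -defG C1 mulg1 normG.
have := card_core_free_factor defG' cycC cycB coreB1 ntC.
by rewrite ltnNge ltnW.
Qed.

(** * Consequences of core-freeness for exponents, and centralisers *)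

(* Every e-th power of an element of A lies in U, and A is normal. *)
Lemma expg_core_free (gT : finGroupType) (G A U V : {group gT}) e x :
    abelian A -> G \subset 'N(A) -> U * V = A -> gcore U G = 1 ->
    {in V, forall v, v ^+ e = 1} -> x \in U ->
  x ^+ e = 1.
Proof.
move=> abA nAG defA core1 Ve xU; apply/set1gP; rewrite -core1.
apply/bigcapP=> g gG; rewrite mem_conjg conjXg.
have : x ^ g^-1 \in A.
  by rewrite memJ_norm ?(subsetP nAG) ?groupV // -defA (subsetP (mulG_subl _ _)).
rewrite -defA => /mulsgP[u v uU vV ->].
have [uA vA] : u \in A /\ v \in A.
  rewrite -defA; split; first exact: (subsetP (mulG_subl _ _)).
  exact: (subsetP (mulG_subr _ _)).
by rewrite expgMn ?(Ve v) ?mulg1 ?groupX //; apply: (centsP abA).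
Qed.

(** The commutator is the product of a conjugate of [a^-1] under [g] and of [a], and both centralise
    [H]. *)
Lemma commg_cent_abelian (gT : finGroupType) (A H : {group gT}) a g :
    abelian A -> H \subset A -> a \in A -> g \in 'N(H) ->
  [~ g, a] \in 'C(H).
Proof.
move=> abA sHA aA nHg; apply/centP=> h hH; apply/commute_sym/commgP/conjg_fixP.
have fixa k : k \in H -> k ^ a = k.
  by move=> kH; apply/conjg_fixP/commgP/(centsP abA) => //; apply: (subsetP sHA).
have nHgV : g^-1 \in 'N(H) by rewrite groupV.
have hgV : h ^ g^-1 \in H by rewrite memJ_norm.
have ->: [~ g, a] = g^-1 * a^-1 * g * a by rewrite commgEl conjgE !mulgA.
rewrite !conjgM -[X in X ^ a^-1](fixa _ hgV) conjgK conjgKV.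
exact: fixa.
Qed.

Lemma gcore_quotient (gT : finGroupType) (G H : {group gT}) :
  H \subset G -> gcore (H / gcore H G) (G / gcore H G) = 1.
Proof.
move=> sHG; set K := gcore_group H G.
have nKG : G \subset 'N(K) := gcore_norm H G.
have nsKG : K <| G by apply: gcore_normal.
apply/trivgP; pose L := gcore_group (H / K) (G / K).
have nsL : L <| G / K by rewrite gcore_normal ?quotientS.
have [M defM sKM nsM] := inv_quotientN nsKG nsL.
have sMG := normal_sub nsM; have nKM := subset_trans sMG nKG.
change (gval L \subset [1]); rewrite defM quotient_sub1 // gcore_max ?normal_norm //.
rewrite -(quotientSGK nKM (gcore_sub H G)) -defM.
exact: gcore_sub.
Qed.

(** * The order of the factor x of [b, c] *)

(* Conjugation by b ^+ r maps c to an odd power of c times x ^+ r, so b ^+ j    *)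
(* would not centralise c if j were odd.                                      *)
Lemma parity_twist (gT : finGroupType) (b c x : gT) (i j : nat) :
    #[x] = 2 -> x \notin <[c]> -> commute x c -> ~~ odd #[c] ->
    c ^ b = c ^+ i * x -> b ^+ j = x -> ~~ odd j.
Proof.
move=> ox xC cxc evc cb bj; apply/negP=> oddj.
have x2 : x ^+ 2 = 1 by rewrite -ox expg_order.
have xpar n : x ^+ n = x ^+ odd n.
  by rewrite -{1}(odd_double_half n) expgD -mul2n expgM x2 expg1n mulg1.
have xb : x ^ b = x.
  by apply/conjg_fixP/commgP; rewrite -bj; apply/commute_sym/commuteX.
have cxn m n : commute (c ^+ m) (x ^+ n) by apply: commuteX2; apply: commute_sym.
have oddi : odd i.
  apply: contraR xC => evi; pose h := #[c]./2.
  have dh : #[c] = (2 * h)%N by rewrite mul2n even_halfK.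
  have Dch : c ^+ h = x ^+ h.
    apply: (conjg_inj b); rewrite !conjXg xb cb expgMn; last exact: (cxn i 1%N).
    rewrite -expgM -(even_halfK evi) -mul2n mulnAC -dh.
    by rewrite expgM expg_order expg1n mul1g.
  have h0 : (0 < h)%N by have := order_gt0 c; rewrite dh; case: h {dh Dch}.
  have : c ^+ h != 1.
    rewrite -order_dvdn dh gtnNdvd //.
    by rewrite -{1}(mul1n h) ltn_pmul2r.
  rewrite Dch xpar; case: (odd h) (xpar h) => [xh _|_ /eqP//].
  by rewrite -[x]xh -Dch mem_cycle.
have pow r : exists2 i', odd i' & c ^ (b ^+ r) = c ^+ i' * x ^+ r.
  elim: r => [|r [i' oi' IH]]; first by exists 1%N; rewrite // conjg1 mulg1.
  exists (i * i')%N; first by rewrite oddM oddi.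
  rewrite [b ^+ _]expgSr conjgM IH conjMg !conjXg xb cb expgMn; last exact: (cxn i 1%N).
  by rewrite -expgM -mulgA -expgD; congr (_ * _); rewrite [LHS]xpar [RHS]xpar oddD oi'.
have [i' _] := pow j.
have -> : c ^ (b ^+ j) = c by rewrite bj; apply/conjg_fixP/commgP/commute_sym.
rewrite xpar oddj => /(canLR (mulKg _)) Dx.
by case/negP: xC; rewrite -[x]Dx groupM ?groupV ?mem_cycle ?cycle_id.
Qed.

Lemma cycle_conj_odd (gT : finGroupType) (x g : gT) :
  g \in 'N(<[x]>) -> ~~ odd #[x] -> exists2 i, odd i & x ^ g = x ^+ i.
Proof.
move=> nxg evx.
have /cycleP[i xg] : x ^ g \in <[x]> by rewrite memJ_norm ?cycle_id.
exists i => //; have : coprime #[x] i.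
  by rewrite -generator_coprime /generator -xg cycleJ (normP nxg).
by rewrite -coprime2n; apply: coprime_dvdl; rewrite dvdn2.
Qed.

Lemma odd_sqr_mod4 i : odd i -> i * i = 1 %[mod 4].
Proof. by move=> oi; rewrite -(odd_double_half i) oi; lia. Qed.

(** The product of [<[c]>] and its conjugate by [b] has order [#[c]] squared and lies in [<[c]> *
    <[x]>], which gives the inequality. If [#[b] %/ #[x]] were odd, [parity_twist] would fail modulo
    the squares in [<[x]>]. *)
Lemma twist_order (gT : finGroupType) (G : {group gT}) (b c x f : gT) :
    <[b]> * <[c]> = G -> gcore <[c]> G = 1 -> c != 1 ->
    x \in <[b]> -> f \in <[c]> -> [~ b, c] = x * f -> G \subset 'N(<[x]>) ->
    #[x] %| 4 ->
  (#[c] <= #[x])%N /\ (2 * #[x] %| #[b])%N.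
Proof.
move=> defG core1 ntc xb fc Dbc nxG u4.
have bG : b \in G by rewrite -defG (subsetP (mulG_subl _ _)) ?cycle_id.
have cG : c \in G by rewrite -defG (subsetP (mulG_subr _ _)) ?cycle_id.
have xG : x \in G by rewrite -defG (subsetP (mulG_subl _ _)).
have defG' : G = <<b |: <[c]> >> :> {set gT} by apply: mulg_gen_cycle.
have TIc : <[c]> :&: <[c]> :^ b = 1.
  by apply: (@gcore_TI_conj _ G) core1; rewrite ?cycle_cyclic // -defG'.
have TIbc := TI_core_free_factor defG core1.
have Dcb : c ^ b = c * f^-1 * x^-1.
  by rewrite -mulgA -invMg -Dbc invg_comm commgEl mulKVg.
have nxc : c \in 'N(<[x]>) by apply: (subsetP nxG).
have CX : <[c]> * <[x]> = <[c]> <*> <[x]>.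
  by rewrite norm_joinEl ?cycle_subG.
have cbCX : c ^ b \in <[c]> * <[x]>.
  by rewrite Dcb mem_mulg ?groupV ?cycle_id // groupM ?groupV ?cycle_id.
have leq_cx : (#[c] <= #[x])%N.
  have sCC : <[c]> * <[c]> :^ b \subset <[c]> * <[x]>.
    by rewrite CX mul_subG ?joing_subl // -cycleJ cycle_subG /= -CX.
  have := subset_leq_card sCC; rewrite (TI_cardMg TIc) cardJg => le1.
  have le2 : (#|(<[c]> * <[x]>)%g| <= #[c] * #[x])%N.
    by rewrite !orderE mul_cardG leq_pmulr ?cardG_gt0.
  by have := leq_trans le1 le2; rewrite leq_pmul2l ?cardG_gt0.
have c1 : (1 < #[c])%N by rewrite ltnNge -trivg_card_le1 cycle_eq1.
have u1 : (1 < #[x])%N := leq_trans c1 leq_cx.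
have evu : ~~ odd #[x].
  by have := @dvdn_leq _ 4 isT u4; move: u1 u4; case: #[x] => [|[|[|[|[|]]]]].
have [i oi xc] := cycle_conj_odd nxc evu.
(* Odd squares are 1 modulo 4, so [c ^+ 2] centralises [x]; for odd [#[c]] so does [c]. Then [<[c]>
   <*> <[x]>] is abelian and normal, and [expg_core_free] makes [#[c]] divide 4. *)
have evc : ~~ odd #[c].
  apply/negP=> oc; have xc2 : commute x (c ^+ 2).
    apply/commgP/conjg_fixP; rewrite conjgM xc conjXg xc -expgM.
    apply/eqP; rewrite -{2}[x]expg1 eq_expg_mod_order; apply/eqP.
    by rewrite -(modn_dvdm _ u4) odd_sqr_mod4 // modn_dvdm.
  have cxc : commute x c.
    have -> : c = (c ^+ 2) ^+ (uphalf #[c]).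
      by rewrite -expgM mul2n odd_uphalfK // expgS expg_order mulg1.
    exact: commuteX.
  have abA : abelian (<[c]> <*> <[x]>).
    rewrite abelianY !cycle_abelian /= cycle_subG.
    by rewrite /= cent_cycle; apply/cent1P/commute_sym.

  have nAG : G \subset 'N(<[c]> <*> <[x]>).
    rewrite defG' gen_subG subUset sub1set.
    rewrite inE -{1}CX conjsMg mul_subG /=.
    - exact: subset_trans (joing_subl _ _) (normG _).
    - by rewrite -cycleJ cycle_subG /= -CX.
    - by rewrite (normsP nxG) // joing_subr.
  have cu : c ^+ #[x] = 1.
    apply: (expg_core_free abA nAG CX core1) (cycle_id c) => v.
    by case/cycleP=> n ->; rewrite -expgM mulnC expgM expg_order expg1n.
  have /eqP := cu; rewrite -order_dvdn => /dvdn_trans/(_ u4) c4.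
  have := @dvdn_leq _ 4 isT c4; move: c1 c4 oc.
  by case: #[c] => [|[|[|[|[|]]]]].
split=> //.
have u_b : #[x] %| #[b] by apply: order_dvdG.
pose j := (#[b] %/ #[x])%N.
have Db : #[b] = (j * #[x])%N by rewrite divnK.
rewrite Db dvdn_pmul2r ?order_gt0 // dvdn2; apply/negP=> oj.
have obj : #[b ^+ j] = #[x].
  by rewrite orderXdiv ?dvdn_div // /j divnA // mulKn.
have eqX : <[b ^+ j]> = <[x]>.
  apply/eqP; rewrite (eq_subG_cyclic (cycle_cyclic b)) ?cycle_subG ?mem_cycle //.
  by rewrite -!orderE obj.
have [o Dbj] : exists o, b ^+ j = x ^+ o.
  by apply/cycleP; rewrite -eqX cycle_id.
have oo : odd o.
  have : coprime #[x] o by rewrite -generator_coprime /generator -Dbj eqX.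
  by rewrite -coprime2n; apply: coprime_dvdl; rewrite dvdn2.
(* Modulo [N] the image of [x] is an involution, while [c] keeps its order since [N] lies in [<[b]>]
   and so meets [<[c]>] trivially. *)
pose N := <[x ^+ 2]>%G.
have nNG : G \subset 'N(N).
  apply: char_norm_trans nxG.
  by rewrite sub_cyclic_char ?cycle_cyclic // cycle_subG mem_cycle.
have nN g : g \in G -> g \in 'N(N) by apply: (subsetP nNG).
have sNb : N \subset <[b]> by rewrite cycle_subG groupX.
have xN : x \notin N.
  apply/negP=> xN; have : #[x] %| #[x ^+ 2] by apply: order_dvdG.
  rewrite orderXdiv ?dvdn2 // => /dvdn_leq.
  by rewrite divn_gt0 // dvdn_leq ?dvdn2 // leqNgt ltn_Pdiv ?order_gt0 // => /(_ isT).
have cX n : coset N (c ^+ n) = coset N c ^+ n by rewrite morphX ?nN.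
have xX n : coset N (x ^+ n) = coset N x ^+ n by rewrite morphX ?nN.
have x2 : coset N x ^+ 2 = 1 by rewrite -xX coset_id ?cycle_id.
have x2odd n : odd n -> coset N x ^+ n = coset N x.
  by move=> on; rewrite -(odd_double_half n) on -mul2n expgD expgM x2 expg1n mulg1.
have ox : #[coset N x] = 2.
  by apply: nt_prime_order => //; apply: contraNneq xN => /coset_idr->; rewrite ?nN.
have oc : #[coset N c] = #[c].
  apply/eqP; rewrite eqn_dvd morph_order ?nN //= order_dvdn.
  apply/eqP/set1gP; rewrite -TIbc inE mem_cycle andbT (subsetP sNb) //.
  by apply: coset_idr; rewrite ?nN ?groupX // cX expg_order.
have : ~~ odd j.
  have [k Dk] : exists k, c * f^-1 = c ^+ k.
    by apply/cycleP; rewrite groupM ?groupV ?cycle_id.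
  apply: (@parity_twist _ (coset N b) (coset N c) (coset N x) k); rewrite ?oc //.
  - apply/cycleP=> -[n]; rewrite -cX.
    move/(rcoset_kercosetP (nN _ xG) (nN _ (groupX n cG))).
    case/rcosetP=> v vN Dx; have : c ^+ n \in <[b]> :&: <[c]>.
      rewrite inE mem_cycle andbT -(groupMl _ (subsetP sNb v vN)) -Dx //.
    rewrite TIbc => /set1gP cn1; case/negP: xN.
    by rewrite Dx cn1 mulg1.
  - apply/commgP/conjg_fixP; rewrite -morphJ ?nN // xc /= xX x2odd //.
  - rewrite -morphJ ?nN //= Dcb Dk morphM ?nN ?groupV ?groupX //= cX; congr (_ * _).
    by rewrite morphV ?nN //; apply/eqP; rewrite eq_invg_mul -expg2 x2.
  - by rewrite -morphX ?nN //= Dbj xX x2odd.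
by rewrite oj.
Qed.

(** * Powers of g f, and the exclusion of order 2 *)

Lemma expg_mem_subcycle (gT : finGroupType) (b : gT) (K : {group gT}) m :
  K \subset <[b]> -> (b ^+ m \in K) = (#|<[b]> : K| %| m).
Proof.
move=> sKb; have nKb : <[b]> \subset 'N(K).
  apply: subset_trans (cycle_abelian b) _.
  exact: subset_trans (centS sKb) (cent_sub _).
have nb : b \in 'N(K) by rewrite -cycle_subG.
rewrite -card_quotient // quotient_cycle // -orderE order_dvdn -morphX //=.
by apply/idP/eqP => [/coset_id | /coset_idr->]; rewrite ?groupX.
Qed.

Lemma geom_sumS a N :
  (\sum_(i < N.+1) a ^ i = a * (\sum_(i < N) a ^ i) + 1)%N.
Proof.
rewrite big_ord_recl expn0 addnC; congr (_ + _)%N.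
by rewrite big_distrr; apply: eq_bigr => i _; rewrite lift0 expnS.
Qed.

Lemma geom_sumD a j :
  (\sum_(i < j + j) a ^ i = \sum_(i < j) a ^ i + a ^ j * \sum_(i < j) a ^ i)%N.
Proof.
rewrite big_split_ord; congr (_ + _)%N; rewrite big_distrr.
by apply: eq_bigr => i _; rewrite /= expnD.
Qed.

(** Modulo [K], moving [f] past [g] raises it to the power [a]; the factors from [K] commute with
    [g] and [f] and can be collected on the right. *)
Lemma expgM_geom_sum (gT : finGroupType) (K : {group gT}) (g f k : gT) a N :
    g \in 'C(K) -> f \in 'C(K) -> k \in K -> f ^ g = f ^+ a * k ->
  exists2 k', k' \in K & (g * f) ^+ N = g ^+ N * f ^+ (\sum_(i < N) a ^ i) * k'.
Proof.
move=> cg cf kK fg; elim: N => [|N [k' k'K IH]].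
  by exists 1; rewrite ?group1 // big_ord0 !mulg1.
have cK x u : x \in 'C(K) -> u \in K -> commute u x.
  by move=> /centP cx uK; apply/commute_sym/cx.
set S := (\sum_(i < N) _)%N in IH.
exists (k ^+ S * k'); first by rewrite groupM ?groupX.
rewrite expgSr IH geom_sumS -/S expgD expg1 expgM.
have -> : g ^+ N * f ^+ S * k' * (g * f) = g ^+ N * (g * (f ^+ S) ^ g) * k' * f.
  by rewrite -conjgC -!mulgA (mulgA k') (cK g k') ?mulgA.
rewrite conjXg fg expgMn; last by apply/commute_sym/cK; rewrite ?groupX.
rewrite expgSr -!mulgA; congr (_ * (_ * (_ * _))).
rewrite (mulgA _ k') (cK f (k ^+ S * k')) ?groupM ?groupX //.
Qed.

(** Here [v] is the product of the conjugates [f ^ (g ^+ i)] for i < N. Their [t]-th powers are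
    [d * k ^+ i], and these exponents i sum to the binomial coefficient. *)
Lemma expgM_binomial (gT : finGroupType) (F : {group gT}) (g f d k : gT) t N :
    abelian F -> g \in 'N(F) -> f \in F -> k \in F ->
    f ^+ t = d -> d ^ g = d * k -> k ^ g = k ->
  exists2 v, v \in F /\ v ^+ t = d ^+ N * k ^+ 'C(N, 2) &
    (g * f) ^+ N = g ^+ N * v.
Proof.
move=> abF nFg fF kF ft dg kg; have dF : d \in F by rewrite -ft groupX.
have cF u v : u \in F -> v \in F -> commute u v.
  by move=> uF vF; apply: (centsP abF).
elim: N => [|N [v [vF vt] IH]]; first by exists 1; rewrite ?mulg1 ?expg1n.
have vgF : v ^ g \in F by rewrite memJ_norm.
exists (v ^ g * f).
  split; first by rewrite groupM.
  rewrite expgMn; last exact: cF.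
  rewrite -conjXg vt ft conjMg !conjXg dg kg expgMn; last exact: cF.
  rewrite binS bin1 expgD expgSr -!mulgA; congr (_ * _).
  by rewrite mulgA -!expgD addnC; apply: cF; rewrite ?groupX.
by rewrite expgSr IH expgSr conjgE !mulgA mulgK.
Qed.

Lemma twist_arith a j h k S :
    odd a -> S = (\sum_(i < j) a ^ i)%N -> ~~ odd j -> h %| k ->
    h %| (S + S)%N -> ~~ (h %| S) -> ~~ (32 %| (k * (2 * j))%N) ->
  exists t t' t'', [/\ k = 4 * t, j = 2 * t', h = 4 * t'' & a = 1 %[mod 4]]%N
     /\ [&& odd t, odd t' & odd t''].
Proof.
move=> oa defS evj hk h2S hS n32.
have odd_S i : odd (\sum_(i0 < i) a ^ i0)%N = odd i.
  by elim: i => [|i IH]; rewrite ?big_ord0 // geom_sumS oddD oddM oa IH addbT.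
have evS : ~~ odd S by rewrite defS odd_S.
have evh : ~~ odd h.
  apply: contra hS => oh; move: h2S; rewrite addnn -muln2 Gauss_dvdl //.
  by rewrite coprimen2.
pose h' := h./2; have Dh : h = (2 * h')%N by rewrite mul2n even_halfK.
have h'S : h' %| S by move: h2S; rewrite addnn -mul2n Dh dvdn_pmul2l.
have [s DS] := dvdnP h'S.
have os : odd s.
  apply: contraR hS => evs; rewrite DS Dh -(even_halfK evs) -mul2n mulnAC.
  by rewrite dvdn_mulr.
have evh' : ~~ odd h' by move: evS; rewrite DS oddM os.
pose t'' := h'./2; have Dh' : h' = (2 * t'')%N by rewrite mul2n even_halfK.
have Dh4 : h = (4 * t'')%N by rewrite Dh Dh' mulnA.
have [k1 Dk] := dvdnP hk.
pose t := (k1 * t'')%N; have Dk4 : k = (4 * t)%N by rewrite Dk Dh4 /t mulnCA.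
pose t' := j./2; have Dj : j = (2 * t')%N by rewrite mul2n even_halfK.
have ott : odd (t * t').
  apply: contraR n32 => ev; apply/dvdnP; exists (t * t')./2.
  have -> : (k * (2 * j) = 16 * (t * t'))%N.
    by rewrite Dk4 Dj (mulnA 2 2) mulnACA.
  by rewrite -{1}(even_halfK ev) -mul2n mulnA mulnC.
have [ot ot'] : odd t /\ odd t' by move: ott; rewrite oddM => /andP[].
have ot'' : odd t'' by move: ot; rewrite oddM => /andP[].
exists t, t', t''; split; [split=> // | exact/and3P].
have a_cases : (a %% 4 = 1 \/ a %% 4 = 3)%N.
  have := ltn_pmod a (isT : 0 < 4)%N; have := @odd_mod a 4 (erefl _).
  by rewrite oa; case: (a %% 4)%N => [|[|[|[|]]]] //; auto.
case: a_cases => [-> // | a3].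
have S4 m : 4 %| (\sum_(i < m.*2) a ^ i)%N.
  elim: m => [|m IH]; first by rewrite big_ord0.
  rewrite doubleS !geom_sumS mulnDr mulnA muln1 -addnA dvdn_add //.
    by rewrite dvdn_mull.
  by rewrite /dvdn -modnDml a3.
have : 4 %| S by rewrite defS Dj mul2n S4.
rewrite DS Dh' mulnCA (@dvdn_pmul2l 2 2) // dvdn2 oddM os ot''.
by [].
Qed.

Lemma double_odd_mod4 m : odd m -> 2 * m = 2 %[mod 4].
Proof. by move=> om; rewrite -(odd_double_half m) om; lia. Qed.

Lemma bin2_mod4 m : odd m -> 'C(4 * m, 2) = 2 %[mod 4].
Proof.
move=> om; rewrite bin2 -[RHS](@double_odd_mod4 (m * (4 * m).-1)).
  by congr (_ %% _)%N; rewrite -[4]/(2 * 2)%N -!mulnA mul2n doubleK.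
rewrite oddM om /=; case: m om => // m _.
by rewrite mulnS /= oddM.
Qed.

Lemma twist_order2_absurd (gT : finGroupType) (G K : {group gT})
    (b c x f k : gT) (a : nat) :
    <[b]> * <[c]> = G -> gcore <[c]> G = 1 -> K :=: gcore <[b]> G ->
    x \in <[b]> -> x \notin K -> x ^+ 2 \in K ->
    f \in <[c]> -> f \in 'C(K) -> f ^+ #|K| = 1 -> [~ f, x] \in K ->
    f ^ b = f ^+ a * k -> k \in K -> [~ b, c] = x * f ->
    4 %| #|<[b]> : K| -> ~~ (32 %| #[b]) ->
  False.
Proof.
move=> defG core1 defK xb xK x2K fc fCK fK1 fxK fb kK bc n4 n32.
have TI := TI_core_free_factor defG core1.
have bG : b \in G by rewrite -defG (subsetP (mulG_subl _ _)) ?cycle_id.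
have cG : c \in G by rewrite -defG (subsetP (mulG_subr _ _)) ?cycle_id.
have sKb : K \subset <[b]> by rewrite defK gcore_sub.
have nKG : G \subset 'N(K) by rewrite defK gcore_norm.
have nKb : b \in 'N(K) by apply: (subsetP nKG).
have nKc : c \in 'N(K) by apply: (subsetP nKG).
have bCK g : g \in <[b]> -> g \in 'C(K).
  by apply: subsetP; apply: subset_trans (cycle_abelian b) (centS sKb).
have cK u v : u \in K -> v \in 'C(K) -> commute u v.
  by move=> uK /centP cv; apply/commute_sym/cv.
have Kc1 u : u \in K -> u \in <[c]> -> u = 1.
  by move=> uK uc; apply/set1gP; rewrite -TI inE (subsetP sKb).
have normal_b u : u \in <[b]> -> u ^ c \in <[b]> -> u \in K.
  move=> ub ucb; rewrite -cycle_subG defK gcore_max ?cycle_subG //.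
  rewrite -defG mul_subG //; last first.
    rewrite cycle_subG; apply/normP/eqP; rewrite -cycleJ.
    by rewrite (eq_subG_cyclic (cycle_cyclic b)) ?cycle_subG //= -!orderE orderJ.
  apply: subset_trans (cycle_abelian b) _; apply: subset_trans (cent_sub _).
  by rewrite centS ?cycle_subG.
have normal_c u : u \in <[c]> -> u ^ b = u -> u = 1.
  move=> uc ub; apply/set1gP; rewrite -core1 -cycle_subG gcore_max ?cycle_subG //.
  rewrite -defG mul_subG //.
    rewrite cycle_subG; apply/normP/eqP; rewrite -cycleJ.
    by rewrite ub.
  apply: subset_trans (cycle_abelian c) _; apply: subset_trans (cent_sub _).
  by rewrite centS ?cycle_subG.
set nb := #|<[b]> : K| in n4.
have bK m : (b ^+ m \in K) = (nb %| m) by apply: expg_mem_subcycle.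
pose j := nb./2.
have Dnb : nb = (2 * j)%N by rewrite mul2n even_halfK // -dvdn2 (dvdn_trans _ n4).
have evj : ~~ odd j by rewrite -dvdn2 -(@dvdn_pmul2l 2) // -Dnb.
pose y := b ^+ j.
have ybG : y \in <[b]> by apply: mem_cycle.
have [o [oo Dx]] : exists o, odd o /\ x = b ^+ (j * o).
  have /cycleP[s Dx] := xb.
  have : nb %| s * 2 by rewrite -bK expgM -Dx.
  rewrite Dnb mulnC dvdn_pmul2r // => /dvdnP[o Ds]; exists o.
  rewrite Dx Ds mulnC; split=> //; apply: contraR xK => evo.
  by rewrite Dx bK Ds Dnb dvdn_mul // dvdn2.
pose g := b * x.
have Dg : g = b ^+ (1 + j * o) by rewrite expgD expg1 -Dx.
have gb : g \in <[b]> by rewrite Dg mem_cycle.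
have Dbc : b ^ c = g * f by rewrite -mulgA -bc commgEl mulKVg.
have fx : f ^ x = f * [~ f, x] by rewrite commgEl mulKVg.
have fg : f ^ g = f ^+ a * ([~ f, x] ^+ a * k).
  rewrite conjgM fb conjMg conjXg fx expgMn; last first.
    by apply/commute_sym/cK.
  rewrite -!mulgA; do 2!congr (_ * _).
  by apply/conjg_fixP/commgP/cK/bCK.
set kg := _ * k in fg.
have kgK : kg \in K by rewrite groupM ?groupX.
pose S N := (\sum_(i < N) a ^ i)%N.
have pow_gf N : exists2 k', k' \in K & (g * f) ^+ N = g ^+ N * f ^+ (S N) * k'.
  by apply: expgM_geom_sum fg => //; apply: bCK.
have fSb N : (b ^+ N) ^ c \in <[b]> -> #[f] %| S N.
  have [k' k'K Dgf] := pow_gf N; rewrite conjXg Dbc Dgf.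
  rewrite (groupMr _ (subsetP sKb _ k'K)) (groupMl _ (groupX N gb)) => fSb.
  rewrite order_dvdn; apply/eqP/set1gP.
  by rewrite -TI inE fSb groupX.
have Sb N : #[f] %| S N -> (b ^+ N) ^ c \in <[b]>.
  have [k' k'K Dgf] := pow_gf N; rewrite order_dvdn conjXg Dbc Dgf => /eqP->.
  by rewrite mulg1 groupM ?groupX // (subsetP sKb).
(* N = j and N = 2 j: b ^+ j is an involution modulo K, not normal in G / K. *)
have hS : ~~ (#[f] %| S j).
  apply: contra xK => /Sb /(normal_b _ ybG) yK.
  by rewrite Dx expgM groupX.
have y2K : y ^+ 2 \in K by rewrite -expgM bK Dnb mulnC.
(* [y] and [x] agree modulo [K] and [x] centralises [f] modulo [K], so both sides agree modulo [K];
   [K] meets [<[c]>] trivially. *)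
have faj : f ^+ (a ^ j) = f.
  have fbN N : exists2 k', k' \in K & f ^ (b ^+ N) = f ^+ (a ^ N) * k'.
    elim: N => [|N [k' k'K IH]]; first by exists 1; rewrite // conjg1 mulg1.
    exists (k ^+ (a ^ N) * k'); first by rewrite groupM ?groupX.
    rewrite expgSr conjgM IH conjMg conjXg fb expgMn; last first.
      by apply/commute_sym/cK; rewrite ?groupX.
    rewrite -expgM -expnS -!mulgA; do 2!congr (_ * _).
    by apply/conjg_fixP/commgP/cK => //; rewrite bCK ?cycle_id.
  have [k' k'K fy] := fbN j.
  have [u uK Dy] : exists2 u, u \in K & y = x * u.
    exists ((y ^+ 2) ^+ o./2)^-1; first by rewrite groupV groupX.
    suff -> : x = y * (y ^+ 2) ^+ o./2 by rewrite mulgK.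
    by rewrite Dx expgM -/y -{1}(odd_double_half o) oo -mul2n expgD expg1 expgM.
  have {}fy : f ^+ (a ^ j) * k' = f * [~ f, x].
    rewrite -fy -/y Dy conjgM fx; apply/conjg_fixP/commgP/commute_sym/cK => //.
    rewrite groupM //; apply: bCK; exact: (subsetP sKb).
  have : f^-1 * f ^+ (a ^ j) = [~ f, x] * k'^-1.
    by apply: (canRL (mulgK _)); rewrite -mulgA fy mulKg.
  move=> E; apply: (mulgI f^-1); rewrite mulVg; apply: Kc1.
    by rewrite E groupM ?groupV.
  by rewrite groupM ?groupV ?groupX.
have h2S : #[f] %| (S j + S j)%N.
  have : #[f] %| S (j + j)%N.
    apply: fSb; apply: (subsetP sKb); rewrite memJ_norm // bK Dnb.
    by rewrite addnn mul2n.
  rewrite /S geom_sumD -/(S j) !order_dvdn !expgD.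
  by rewrite expgM faj.
have hk : #[f] %| #|K| by rewrite order_dvdn fK1.
have [||t [t' [t'' [[Dk Dj Dh a1] /and3P[ot ot' ot'']]]]] :=
    twist_arith _ (erefl (S j)) evj hk h2S hS.
(* For even [a], conjugation by [b] would send the involution of [<[f]>] into [K], hence that
   involution would lie in [K] and be trivial. *)
- apply: contraR (hS) => eva.
  have evf : ~~ odd #[f].
    apply: contra hS => oh; move: h2S; rewrite addnn -muln2 Gauss_dvdl //.
    by rewrite coprimen2.
  have fK2 : f ^+ #[f]./2 \in K.
    rewrite -(memJ_norm _ nKb) conjXg fb expgMn; last first.
      by apply/commute_sym/cK; rewrite ?groupX.
    rewrite -expgM -(even_halfK eva) -muln2 -mulnA mul2n even_halfK //.
    by rewrite mulnC expgM expg_order expg1n mul1g groupX.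
  have /eqP := Kc1 _ fK2 (groupX _ fc).
  rewrite -order_dvdn => /dvdn_leq; have := order_gt0 f.
  have := even_halfK evf; case: #[f]./2 => [|n] <- //= _ /(_ isT).
  by rewrite -addnn -[X in (_ <= X)%N]addn0 leq_add2l.
- by rewrite -Dnb /nb Lagrange.
have f4 : f ^+ t'' ^+ 4 = 1 by rewrite -expgM mulnC -Dh expg_order.
have [d Dd] : {d | d = f ^+ t''} by exists (f ^+ t'').
have [u Du] : {u | u = k ^+ t''} by exists (k ^+ t'').
rewrite -Dd in f4.
have mod4 (v : gT) m n : v ^+ 4 = 1 -> m = n %[mod 4] -> v ^+ m = v ^+ n.
  move=> v4 mn; rewrite (divn_eq m 4) (divn_eq n 4) mn !expgD.
  by rewrite ![(_ * 4)%N]mulnC !expgM v4 !expg1n.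
have uK : u \in K by rewrite Du groupX.
have dc : d \in <[c]> by rewrite Dd groupX.
have dCK : d \in 'C(K) by rewrite Dd groupX.
have db : d ^ b = d * u.
  rewrite Dd Du conjXg fb expgMn; last by apply/commute_sym/cK; rewrite ?groupX.
  by congr (_ * _); rewrite -expgM mulnC expgM -Dd (mod4 _ _ _ f4 a1).
have ud : commute d u by apply/commute_sym/cK.
have u4 : u ^+ 4 = 1.
  have := congr1 (fun z => z ^ b) f4; rewrite conjXg conj1g db expgMn //.
  by rewrite f4 mul1g.
have u2 : u ^+ 2 != 1.
  apply: contra hS => /eqP u2; have : d ^+ 2 = 1.
    by apply: normal_c; rewrite ?groupX // conjXg db expgMn // u2 mulg1.
  move/eqP; rewrite Dd -expgM -order_dvdn Dh mulnC.
  by rewrite dvdn_pmul2l //; case: (t'') ot''.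
have ub : u ^ b = u by apply/conjg_fixP/commgP/cK/bCK/cycle_id.
have dbN i : d ^ (b ^+ i) = d * u ^+ i.
  elim: i => [|i IH]; first by rewrite conjg1 mulg1.
  by rewrite expgSr conjgM IH conjMg conjXg ub db expgS mulgA.
have o3 : 1 + j * o = 3 %[mod 4].
  by rewrite Dj -mulnA -modnDmr double_odd_mod4 // oddM ot'.
have dg : d ^ g = d * u ^+ 3 by rewrite Dg dbN (mod4 _ _ _ u4 o3).
(* b ^ c = g * f, and both f and c centralise d. *)
have uc : u ^ c = u ^+ 3.
  apply: (mulgI d); have dcc : d ^ c = d.
    by apply/conjg_fixP/commgP/(centsP (cycle_abelian c)) => //; apply: cycle_id.
  have dcV : d ^ c^-1 = d by rewrite -{1}dcc conjgK.
  transitivity (d ^ (b ^ c)).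
    by rewrite [b ^ c]conjgE !conjgM dcV db conjMg dcc.
  rewrite Dbc conjgM dg conjMg; congr (_ * _).
    by apply/conjg_fixP/commgP/(centsP (cycle_abelian c)).
  by apply/conjg_fixP/commgP/cK; rewrite ?groupX.
(* A quarter of [#[b]]: [b ^+ N] generates the subgroup of order 4 of [<[b]>], which is [<[u]>], and
   [c] inverts it. *)
pose N := (4 * (t * t'))%N.
have ou : #[u] = 4.
  apply: (@orderXprime _ 2 2) => //; apply: nt_prime_order => //.
  by rewrite -expgM.
have obN : #[b ^+ N] = 4.
  have Db : #[b] = (4 * N)%N.
    rewrite [LHS]orderE -(Lagrange sKb) -/nb Dnb Dk Dj /N.
    by rewrite (mulnA 2 2) mulnACA -mulnA.
  have N0 : (0 < N)%N by rewrite muln_gt0 /=; apply: odd_gt0; rewrite oddM ot.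
  by rewrite orderXdiv Db; [rewrite mulnK | rewrite dvdn_mull].
have bN4 : (b ^+ N) ^+ 4 = 1 by rewrite -obN expg_order.
have bNc : (b ^+ N) ^ c = (b ^+ N) ^+ 3.
  have /cycleP[e ->] : b ^+ N \in <[u]>.
    rewrite -cycle_subG -(cardSg_cyclic (cycle_cyclic b)) ?cycle_subG ?mem_cycle //.
      by rewrite -!orderE ou obN.
    exact: (subsetP sKb).
  by rewrite conjXg uc -!expgM mulnC.
pose F := <[f]> <*> K.
have [v [vF vt] Dv] : exists2 v, v \in F /\ v ^+ t'' = d ^+ N * (u ^+ 3) ^+ 'C(N, 2) &
    (g * f) ^+ N = g ^+ N * v.
  apply: expgM_binomial => //.
  - rewrite abelianY cycle_abelian (abelianS sKb (cycle_abelian b)) /=.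
    by rewrite centsC cycle_subG.
  - have defF : <[f]> * K = <[f]> <*> K.
      by rewrite -cent_joinEl // cycle_subG.
    rewrite inE /= -{1}defF conjsMg mul_subG //.
      rewrite -cycleJ fg cycle_subG /= -defF mem_mulg ?mem_cycle //.
    rewrite (normsP nKG) ?joing_subr //.
    by rewrite -defG (subsetP (mulG_subl _ _)).
  - by rewrite (subsetP (joing_subl _ _)) ?cycle_id.
  - by rewrite (subsetP (joing_subr _ _)) ?groupX.
  - by apply/conjg_fixP/commgP/cK; rewrite ?groupX // bCK.
(* [g ^+ N] is also the cube of [b ^+ N], because [g] is [b ^+ (1 + j * o)] with exponent 3 modulo
   4. *)
have v1 : v = 1.
  apply: (mulgI (g ^+ N)); rewrite -Dv -Dbc -conjXg bNc mulg1 Dg.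
  by rewrite [RHS]expgAC (mod4 _ _ _ bN4 o3).
case/eqP: u2; have : d ^+ N = 1 by rewrite expgM f4 expg1n.
move=> dN; move: vt; rewrite v1 expg1n dN mul1g -expgM mulnC expgM.
rewrite (mod4 _ _ _ u4 (bin2_mod4 _)) ?oddM ?ot //.
by rewrite -expgM (mod4 _ _ 2 u4).
Qed.

(** * The induction on the order of b *)

(** Both numerical hypotheses pass to divisors of [#[b]], so they survive in G / E, where [b] has
    order |<b> : K|. *)
Lemma mulg_gcore_normal (gT : finGroupType) (G : {group gT}) (b c : gT) :
    <[b]> * <[c]> = G -> gcore <[c]> G = 1 ->
    (forall u, (u * u)%N %| #[b] -> u %| 4) -> ~~ (32 %| #[b]) ->
  G \subset 'N(<[c]> * gcore <[b]> G).
Proof.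
have [n] := ubnP #[b]; elim: n gT G b c => // n IHn gT G b c.
rewrite ltnS => leBn defG core1 sq4 n32.
have sbG : <[b]> \subset G by rewrite -defG mulG_subl.
have scG : <[c]> \subset G by rewrite -defG mulG_subr.
have bG : b \in G by rewrite -cycle_subG.
have cG : c \in G by rewrite -cycle_subG.
have TI := TI_core_free_factor defG core1.
pose K := gcore_group <[b]> G.
have [b1 | ntb] := eqVneq <[b]> 1.
  have -> : <[c]> * gcore <[b]> G = G.
    apply/eqP; rewrite eqEsubset mul_subG ?(subset_trans (gcore_sub _ _)) //=.
    by rewrite -{1}defG b1 mul1g mulG_subl.
  exact: normG.
have ntK : K :!=: 1.
  by apply: (gcore_cyclic_neq1 defG); rewrite ?cycle_cyclic.
have nsKG : K <| G by apply: gcore_normal.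
have [sKG nKG] := andP nsKG.
have sKb : K \subset <[b]> by apply: gcore_sub.
pose J := (<[c]> <*> K)%G.
have defJ : <[c]> * K = J by rewrite /= norm_joinEl // (subset_trans scG).
change (G \subset 'N(<[c]> * K)); rewrite defJ.
have sJG : J \subset G by rewrite join_subG scG.
pose E := gcore_group J G.
have nsEG : E <| G by apply: gcore_normal.
have [sEG nEG] := andP nsEG.
have sEJ : E \subset J by apply: gcore_sub.
have sKE : K \subset E by rewrite gcore_max ?joing_subr.
have tiBE : <[b]> :&: E = K.
  apply/eqP; rewrite eqEsubset subsetI sKb sKE !andbT.
  apply: subset_trans (setIS _ sEJ) _; rewrite -defJ.
  by rewrite -group_modr // TI mul1g.
have nE g : g \in G -> g \in 'N(E) by apply: (subsetP nEG).
have nK g : g \in G -> g \in 'N(K) by apply: (subsetP nKG).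
have defGE : <[coset E b]> * <[coset E c]> = G / E.
  by rewrite -!quotient_cycle ?nE // -quotientMl ?defG // (subset_trans sbG).
have core1E : gcore <[coset E c]> (G / E) = 1.
  have -> : <[coset E c]> = J / E.
    rewrite -quotient_cycle ?nE // -defJ quotientMl ?(subset_trans scG) //.
    by rewrite (quotientS1 sKE) mulg1.
  exact: gcore_quotient.
have obE : #[coset E b] = #|<[b]> : K|.
  rewrite orderE -quotient_cycle ?nE // card_quotient ?(subset_trans sbG) //.
  by rewrite -indexgI tiBE.
set nb := #|_ : _| in obE.
have Db : #[b] = (#|K| * nb)%N by rewrite orderE -(Lagrange sKb).
have [c1 | ntc] := eqVneq (coset E c) 1.
  have sJE : J \subset E.
    by rewrite join_subG sKE cycle_subG andbT coset_idr ?nE.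
  suff -> : J :=: E by [].
  by apply/eqP; rewrite eqEsubset sJE.
have sbGE : <[coset E b]> \subset G / E by rewrite -defGE mulG_subl.
have scGE : <[coset E c]> \subset G / E by rewrite -defGE mulG_subr.
pose L := gcore_group <[coset E b]> (G / E).
have nsLG : L <| G / E by rewrite gcore_normal.
have nLG := normal_norm nsLG.
have nCL : G / E \subset 'N(<[coset E c]> * L).
  apply: IHn => //.
  - rewrite obE; apply: leq_trans leBn; rewrite Db ltn_Pmull ?indexg_gt0 //.
    by rewrite cardG_gt1.
  - by move=> u; rewrite obE => uu; apply: sq4; rewrite Db dvdn_mull.
  - by apply: contra n32; rewrite obE Db => /dvdn_mull->.
(* Modulo [E] the commutator lies in the normal subgroup [<[coset E c]> * L]. Lifting its two
   factors leaves an error in [E], hence in [K * <[c]>], which they absorb. *)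
have [x [f [xb fc Dbc xL]]] :
    exists x f, [/\ x \in <[b]>, f \in <[c]>, [~ b, c] = x * f & coset E x \in L].
  have defCL : <[coset E c]> * L = <[coset E c]> <*> L.
    by rewrite norm_joinEl // (subset_trans scGE).
  have : coset E [~ b, c] \in <[coset E c]> * L.
    have cCL : coset E c \in <[coset E c]> <*> L.
      by rewrite (subsetP (joing_subl _ _)) ?cycle_id.
    rewrite defCL morphR ?nE // commgEr groupM // memJ_norm ?groupV //.
    by rewrite /= -defCL (subsetP nCL) ?mem_quotient.
  rewrite normC ?(subset_trans scGE) // => /mulsgP[l f0 lL f0c Dw].
  have /cycleP[i Dl] := subsetP (gcore_sub _ _) l lL.
  have /cycleP[m Df0] := f0c.
  pose e := (b ^+ i)^-1 * [~ b, c] * (c ^+ m)^-1.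
  have biG : b ^+ i \in G by rewrite groupX.
  have cmG : c ^+ m \in G by rewrite groupX.
  have Dbi : coset E (b ^+ i) = l by rewrite morphX ?nE.
  have eG : e \in G by rewrite !groupM ?groupV ?groupR.
  have eE : e \in E.
    apply: coset_idr; rewrite ?nE // /e 2?morphM ?nE ?groupM ?groupV ?groupR //=.
    rewrite Dw !morphV ?nE //= Dbi mulKg Df0 morphX ?nE //.
    exact: mulgV.
  have : e \in K * <[c]>.
    by rewrite -normC ?(subset_trans scG) // defJ (subsetP sEJ).
  case/mulsgP=> z d zK dc De.
  have zE : z \in E by apply: (subsetP sKE).
  exists (b ^+ i * z), (d * c ^+ m); split.
  - by rewrite groupM ?mem_cycle // (subsetP sKb).
  - by rewrite groupM ?mem_cycle.
  - rewrite mulgA -(mulgA _ z) -De /e.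
    by move: [~ b, c] => w; rewrite !mulgA mulgV mul1g mulgKV.
  have zG : z \in G by apply: (subsetP sEG).
  by rewrite morphM ?nE //= Dbi coset_id ?mulg1.
have xG : x \in G by apply: (subsetP sbG).
have fG : f \in G by apply: (subsetP scG).
have nXG : G / E \subset 'N(<[coset E x]>).
  apply: char_norm_trans (normal_norm nsLG).
  rewrite sub_cyclic_char ?cycle_subG //.
  exact: cyclicS (gcore_sub _ _) (cycle_cyclic _).
have sEKc : E / K \subset <[coset K c]>.
  rewrite -quotient_cycle ?nK //; apply: subset_trans (quotientS K sEJ) _.
  by rewrite -defJ quotientMl ?(subset_trans scG) // trivg_quotient mulg1.
(* E / K lies in the cyclic group generated by [coset K c], so [f] centralises it, and so does
   [b, c] by [commg_cent_abelian]. *)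
have cEx : coset K x \in 'C(E / K).
  have cEf : coset K f \in 'C(E / K).
    apply: (subsetP (subset_trans (cycle_abelian (coset K c)) (centS sEKc))).
    by rewrite -quotient_cycle ?nK // mem_quotient.
  rewrite -(groupMr _ cEf) -morphM ?nK //= -Dbc morphR ?nK //=.
  apply: (@commg_cent_abelian _ <[coset K c]>%G (E / K)%G).
  - exact: cycle_abelian.
  - exact: sEKc.
  - exact: cycle_id.
  by rewrite (subsetP (quotient_norms K nEG)) ?mem_quotient.
have xEK e : e \in E -> [~ e, x] \in K.
  move=> eE; have eG := subsetP sEG e eE.
  apply: coset_idr; rewrite ?nK ?groupR // morphR ?nK //=.
  by apply/eqP/commgP/commute_sym; apply: (centP cEx); apply: mem_quotient.
have xCK : x \in 'C(K).
  by apply: subsetP xb; apply: subset_trans (cycle_abelian b) (centS sKb).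
have fCK : f \in 'C(K).
  rewrite -(groupMl _ xCK) -Dbc -groupV invg_comm.
  by apply: (commg_cent_abelian (cycle_abelian b)); rewrite ?cycle_id ?nK.
pose F := (E :&: 'C(K))%G.
have nFG : G \subset 'N(F) by rewrite normsI ?norms_cent.
have abK : abelian K := abelianS sKb (cycle_abelian b).
have sKF : K \subset F by rewrite subsetI sKE.
have defF : (<[c]> :&: F) * K = F.
  rewrite [_ :&: F]setIC group_modr // defJ; apply/setIidPl.
  exact: subset_trans (subsetIl _ _) sEJ.
have abD : abelian (<[c]> :&: F) := abelianS (subsetIl _ _) (cycle_abelian c).
have abF : abelian F.
  rewrite -defF abelianM abD abK /= centsC.
  exact: subset_trans (subsetIr _ _) (subsetIr _ _).
have coreD : gcore (<[c]> :&: F) G = 1.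
  apply/trivgP; rewrite -core1 gcore_max ?gcore_norm //.
  exact: subset_trans (gcore_sub _ _) (subsetIl _ _).
have expD d : d \in <[c]> -> d \in F -> d ^+ #|K| = 1.
  move=> dc dF; apply: (expg_core_free abF nFG defF coreD); last exact/setIP.
  by move=> v vK; apply/eqP; rewrite -order_dvdn order_dvdG.
have cDK : cyclic (<[c]> :&: F) := cyclicS (subsetIl _ _) (cycle_cyclic c).
have dvdDK : #|<[c]> :&: F| %| #|K|.
  have /cyclicP[z defD] := cDK; rewrite defD -orderE order_dvdn; apply/eqP.
  have : z \in <[c]> :&: F by rewrite defD cycle_id.
  by case/setIP=> /expD.
(* [F] bounded the order of [<[c]> :&: F] by |K|. Now [Z / K] is abelian and normal, and [coset K x]
   generates a core-free subgroup since [K] is the core of [<[b]>]; so its order divides that of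
   [<[c]> :&: F]. *)
pose Z := ((<[x]> <*> E) :&: 'C(K))%G.
have defM : <[x]> * E = <[x]> <*> E.
  by rewrite norm_joinEl // cycle_subG nE.
have nMG : G \subset 'N(<[x]> <*> E).
  have nsEM : E <| <[x]> <*> E.
    by rewrite /normal joing_subr join_subG normG cycle_subG nE.
  rewrite -(quotientSGK nEG) ?(subset_trans (joing_subr _ _) (normG _)) //.
  rewrite quotient_normG //= -defM quotientMl ?cycle_subG ?nE //.
  by rewrite trivg_quotient mulg1 quotient_cycle ?nE.
have nZG : G \subset 'N(Z) by rewrite normsI ?norms_cent.
have defZ : <[x]> * F = Z.
  by rewrite group_modl ?defM // cycle_subG.
have defZK : <[coset K x]> * (F / K) = Z / K.
  by rewrite -defZ quotientMl ?quotient_cycle ?cycle_subG ?nK.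
have abZ : abelian (Z / K).
  rewrite -defZK abelianM cycle_abelian quotient_abelian //= centsC cycle_subG.
  by apply: subsetP cEx; rewrite centS // quotientS // subsetIl.
have coreX : gcore <[coset K x]> (G / K) = 1.
  apply/trivgP; rewrite -(gcore_quotient sbG) gcore_max ?gcore_norm //.
  apply: subset_trans (gcore_sub _ _) _.
  by rewrite cycle_subG mem_quotient.
have xD : coset K x ^+ #|<[c]> :&: F| = 1.
  apply: (expg_core_free abZ (quotient_norms K nZG) defZK coreX); last exact: cycle_id.
  have FK : F / K = (<[c]> :&: F) / K.
    rewrite -{1}defF quotientMl ?trivg_quotient ?mulg1 //.
    by rewrite subIset // (subset_trans scG).
  move=> v; rewrite /= FK; case/morphimP=> d nd dD ->; rewrite -morphX //=.
  suff -> : d ^+ #|<[c]> :&: F| = 1 by rewrite morph1.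
  by apply/eqP; rewrite -order_dvdn order_dvdG.
have uK : #[coset K x] %| #|K|.
  by apply: dvdn_trans dvdDK; rewrite order_dvdn xD.
have xEK1 m : x ^+ m \in E -> x ^+ m \in K.
  by move=> xmE; rewrite -tiBE inE groupX.
have oxE : #[coset E x] = #[coset K x].
  apply/eqP; rewrite eqn_dvd !order_dvdn -!morphX ?nE ?nK //=.
  apply/andP; split; apply/eqP/coset_id.
    apply: (subsetP sKE); apply: coset_idr; rewrite ?nK ?groupX //.
    by rewrite morphX ?nK //= expg_order.
  apply: xEK1; apply: coset_idr; rewrite ?nE ?groupX //.
  by rewrite morphX ?nE //= expg_order.
have ub : #[coset K x] %| nb.
  rewrite -obE -oxE; apply: order_dvdG.
  by rewrite (subsetP (gcore_sub _ _) _ xL).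
have u4 : #[coset K x] %| 4 by apply: sq4; rewrite Db dvdn_mul.
have [] : (#[coset E c] <= #[coset E x])%N /\ (2 * #[coset E x])%N %| #[coset E b].
  apply: (@twist_order _ (G / E)%G _ _ _ (coset E f)) => //.
  - exact: (subsetP (gcore_sub _ _) _ xL).
  - by rewrite -quotient_cycle ?nE // mem_quotient.
  - by rewrite -morphR ?nE //= Dbc morphM ?nE.
  - by rewrite oxE.
rewrite oxE obE => lecu dvd2u.
(* Order 4 would make 4 * 8 = 32 divide [#[b]]. *)
have u2 : #[coset K x] = 2.
  have c1 : (1 < #[coset E c])%N by rewrite ltnNge -trivg_card_le1 cycle_eq1.
  have u1 := leq_trans c1 lecu.
  have u32 : ~~ (32 %| #[coset K x] * (2 * #[coset K x]))%N.
    by apply: contra n32 => /dvdn_trans->; rewrite // Db dvdn_mul.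
  have := @dvdn_leq _ 4 isT u4; move: u1 u4 u32.
  by case: #[coset K x] => [|[|[|[|[|]]]]].
rewrite u2 in lecu dvd2u uK.
have xK : x \notin K.
  by apply: contraPN u2 => /coset_id->; rewrite order1.
have x2K : x ^+ 2 \in K.
  by apply: coset_idr; rewrite ?nK ?groupX // morphX ?nK //= -u2 expg_order.
(* Otherwise [f] and [c] agree modulo [E], so [b] conjugates [coset E c] to the inverse of
   [coset E x], putting it in the normal subgroup [L], which meets [<[coset E c]>] trivially. *)
have fE : f \in E.
  apply: coset_idr; rewrite ?nE //.
  have c2 : coset E c ^+ 2 = 1.
    apply/eqP; rewrite -order_dvdn; move: lecu (order_gt0 (coset E c)).
    by case: #[coset E c] => [|[|[|]]].
  have /cycleP[m Df] : coset E f \in <[coset E c]>.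
    by rewrite -quotient_cycle ?nE // mem_quotient.
  rewrite -(odd_double_half m) -mul2n expgD (expgM _ 2) c2 expg1n mulg1 in Df.
  rewrite Df; case: (odd m) Df => //= Df; rewrite expg1 in Df *.
  apply/set1gP; rewrite -(TI_core_free_factor defGE core1E) inE cycle_id andbT.
  apply: (subsetP (gcore_sub _ _ : L \subset _)).
  have cb : coset E c ^ coset E b = (coset E x)^-1.
    have : coset E c ^ coset E b = coset E c * (coset E [~ b, c])^-1.
      by rewrite morphR ?nE //= invg_comm commgEl mulKVg.
    by rewrite Dbc morphM ?nE //= Df invMg mulKVg.
  rewrite -(conjgK (coset E b) (coset E c)) cb memJ_norm ?groupV //.
  by rewrite (subsetP nLG) ?mem_quotient.
have fF : f \in F by rewrite inE fE.
have [a [k [kK fb]]] : exists a k, k \in K /\ f ^ b = f ^+ a * k.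
  have : f ^ b \in F by rewrite memJ_norm // (subsetP nFG).
  rewrite -{1}defF => /mulsgP[d k /setIP[dc dF] kK fb].
  (* Raising [fb] to the power [#[f]] puts [d ^+ #[f]] in [K], so it is 1; a cyclic group has one
     subgroup of each order. *)
  have /cycleP[a Dd] : d \in <[f]>.
    rewrite -cycle_subG -(cardSg_cyclic (cycle_cyclic c)) ?cycle_subG //.
    rewrite -!orderE order_dvdn; apply/eqP/set1gP; rewrite -TI inE (groupX _ dc) andbT.
    have := congr1 (fun z => z ^+ #[f]) fb; rewrite -conjXg expg_order conj1g.
    rewrite expgMn; last by apply: (centsP abF) => //; apply: (subsetP sKF).
    move/esym/(canRL (mulgK _)) ->.
    by rewrite mul1g groupV groupX // (subsetP sKb).
  by exists a, k; rewrite -Dd.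
case: (twist_order2_absurd defG core1 (erefl (gval K)) xb xK x2K fc fCK
        (expD f fc fF) (xEK f fE) fb kK Dbc dvd2u n32).
Qed.

(** * From skew morphisms to factorised groups *)

Definition ltrans (gT : finGroupType) (a : gT) : {perm gT} := perm (@mulgI gT a).

Lemma ltransE (gT : finGroupType) (a x : gT) : ltrans a x = a * x.
Proof. exact: permE. Qed.

Lemma ltransX (gT : finGroupType) (a : gT) n : ltrans a ^+ n = ltrans (a ^+ n).
Proof.
apply/permP=> x; rewrite permX ltransE.
elim: n => [|n IH]; first by rewrite mul1g.
by rewrite iterS IH ltransE expgS mulgA.
Qed.

Lemma order_ltrans (gT : finGroupType) (a : gT) : #[ltrans a] = #[a].
Proof.
apply/eqP; rewrite eqn_dvd !order_dvdn ltransX expg_order.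
apply/andP; split; first by apply/eqP/permP=> x; rewrite ltransE perm1 mul1g.
have /permP/(_ 1) := expg_order (ltrans a).
by rewrite ltransX ltransE perm1 mulg1 => ->.
Qed.

Lemma ltrans_exponent (gT : finGroupType) (phi : {perm gT}) a i :
  is_exponent_at phi a i -> ltrans a * phi = phi ^+ i * ltrans (phi a).
Proof.
by move/forallP=> ai; apply/permP=> x; rewrite !permM !ltransE (eqP (ai x)).
Qed.

Lemma skew_coset_preserving (gT : finGroupType) (b : gT) (phi : {perm gT}) :
    [set: gT] = <[b]> -> (forall u, (u * u)%N %| #[b] -> u %| 4) ->
    ~~ (32 %| #[b]) -> skew_morphism phi ->
  coset_preserving phi.
Proof.
move=> defT sq4 n32 skew; have [phi1 exp_phi] := skew.
pose B := <[ltrans b]>; pose C := <[phi]>.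
have ltB a : ltrans a \in B.
  have /cycleP[i ->] : a \in <[b]> by rewrite -defT inE.
  by rewrite -ltransX mem_cycle.
have memB s : s \in B -> exists a, s = ltrans a.
  by case/cycleP=> i ->; exists (b ^+ i); rewrite ltransX.
have sBC : B * C \subset C * B.
  apply/subsetP=> _ /mulsgP[s _ /memB[a ->] /cycleP[m ->] ->].
  elim: m a => [|m IHm] a.
    by rewrite mulg1 -[ltrans a]mul1g mem_mulg ?group1.
  have [i [_ ai]] := exp_phi a.
  rewrite expgS mulgA (ltrans_exponent ai) -mulgA.
  have /mulsgP[c r cC rB ->] := IHm (phi a).
  by rewrite mulgA mem_mulg // groupM ?mem_cycle.
have commBC : commute B C.
  apply/eqP; rewrite eqEcard sBC /= -(card_invg (B * C)) invMg !invGid.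
  exact: leqnn.
pose G := (<[ltrans b]> <*> <[phi]>)%G.
have defG : B * C = G by rewrite -comm_joingE.
have BG s : s \in B -> s \in G by apply: (subsetP (joing_subl _ _)).
have fix1 s : s \in C -> s 1 = 1.
  case/cycleP=> m ->; rewrite permX; elim: m => // m /= ->.
  exact: phi1.
(* An element of the core has all its conjugates by translations in [C], which fixes 1, so it fixes
   every point. *)
have core1 : gcore C G = 1.
  apply/trivgP/subsetP=> s sK; apply/set1gP/permP=> x; rewrite perm1.
  have : s ^ (ltrans x)^-1 \in C.
    apply: (subsetP (gcore_sub C G)).
    by rewrite memJ_norm // groupV (subsetP (gcore_norm C G)) ?BG.
  move/fix1; rewrite conjgE invgK !permM !ltransE mulg1.
  by move/(canRL (permKV (ltrans x))); rewrite ltransE mulg1.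
pose K := gcore_group B G.
have nCK : G \subset 'N(C * K).
  by apply: mulg_gcore_normal; rewrite ?order_ltrans.
have TI : B :&: C = 1 := TI_core_free_factor defG core1.
have sKB : K \subset B by apply: gcore_sub.
have defCK : C * K = C <*> K.
  rewrite norm_joinEl // (subset_trans _ (gcore_norm B G)) //.
  exact: joing_subr.
move=> a; have [i ai] : exists i, power_function phi a = i by eexists.
rewrite ai; apply/(power_functionP _ _ skew).
have {ai}[i_ord ai] := (power_functionP _ _ skew).1 ai; split=> //.
pose e := a^-1 * phi a.
(* Conjugating [phi] by a translation gives [phi ^+ i * ltrans e], which normality keeps in [C * K];
   and [B] meets [C * K] in [K]. *)
have eK : ltrans e \in K.
  have : phi ^ (ltrans a)^-1 \in C * K.
    rewrite memJ_norm ?groupV ?(subsetP nCK) ?BG //.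
    by rewrite -[phi]mulg1 mem_mulg ?cycle_id.
  have -> : phi ^ (ltrans a)^-1 = phi ^+ i * ltrans e.
    rewrite conjgE invgK mulgA (ltrans_exponent ai) -mulgA; congr (_ * _).
    apply/permP=> z; rewrite permM; apply: (canLR (permK (ltrans a))).
    by rewrite !ltransE /e !mulgA mulgV mul1g.
  have phiCK : phi ^+ i \in C <*> K by rewrite (subsetP (joing_subl _ _)) ?mem_cycle.
  rewrite defCK (groupMl _ phiCK) => eCK.
  suff -> : K :=: B :&: (C * K) by rewrite inE ltB defCK.
  by rewrite -group_modr // TI mul1g.
have [e' De'] : exists e', ltrans e * phi = phi * ltrans e'.
  have : ltrans e ^ phi \in K.
    rewrite memJ_norm // (subsetP (gcore_norm B G)) //.
    by rewrite (subsetP (joing_subr _ _)) ?cycle_id.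
  move/(subsetP sKB)/memB=> [e' De']; exists e'.
  by rewrite -De' -conjgC.
have phi_e z : phi (e * z) = e' * phi z.
  by have /permP/(_ z) := De'; rewrite !permM !ltransE.
have -> : phi a = e * a.
  have abT : abelian [set: gT] by rewrite defT cycle_abelian.
  by rewrite (centsP abT e _ a) ?inE // mulKVg.
apply/forallP=> z; rewrite -mulgA !phi_e -mulgA.
by rewrite (eqP (forallP ai z)).
Qed.

Local Close Scope group_scope.

Theorem theorem7p2 (p : nat) (p_prime : prime p) (p_odd : odd p)
    (gT : finGroupType) (gT_cyclic : cyclic [set: gT])
    (gT_card : #|[set: gT]| = 16 * p)
    (phi : {perm gT}) (phi_skew : skew_morphism phi) :
  coset_preserving phi.
Proof.
have /cyclicP[b defT] := gT_cyclic.
have ob : #[b]%g = 16 * p by rewrite orderE -defT.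
apply: (skew_coset_preserving defT) => //; rewrite ob.
(* The square of [p] does not divide 16p, so [u * u] divides 16. *)
- move=> u uu; have up : coprime u p.
    rewrite coprime_sym prime_coprime //; apply/negP=> pu.
    have : p * p %| 16 * p by apply: dvdn_trans (dvdn_mul pu pu) uu.
    rewrite dvdn_pmul2r ?prime_gt0 // (_ : 16 = 2 ^ 4) // Euclid_dvdX // => /andP[].
    by rewrite dvdn_prime2 // => /eqP p2; rewrite p2 in p_odd.
  have {uu} : u * u %| 16 by rewrite -(@Gauss_dvdl _ _ p) ?coprimeMl ?up.
  case: (leqP u 4) => [|u5 /dvdn_leq]; first by case: u {up} => [|[|[|[|[|]]]]].
  by move/(_ isT); rewrite leqNgt (leq_trans _ (leq_mul u5 u5)).
by rewrite (@dvdn_pmul2l 16 2) // dvdn2 p_odd.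
Qed.
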